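(* Let $\ell \ge 2$ and $k > 2\ell+1$ be fixed integers. Then $$\Omega\left(\max\left\{n^{\frac{\ell+1}{3\ell-1}},\, n^{\frac{\ell+1}{k-1}}\right\}\right) = g(n,k,\ell) = O\left(n^{\frac{\ell+1}{2\ell}} (\log n)^{\frac{1}{\ell}}\right),$$ i.e., there are constants $c, C > 0$ depending only on $k,\ell$ such that for all sufficiently large $n$, $c\max\{n^{\frac{\ell+1}{3\ell-1}}, n^{\frac{\ell+1}{k-1}}\} \le g(n,k,\ell) \le C n^{\frac{\ell+1}{2\ell}} (\log n)^{1/\ell}$.
   Context: A $k$-graph is a family of $k$-element subsets (edges) of a finite vertex set. A set of vertices is independent if it contains no edge; $\alpha(\mathcal{H})$ is the maximum size of an independent set. For integers $k > \ell \ge 1$, an $(n,k,\ell)$-omitting system is a $k$-graph on $n$ vertices with no two edges whose intersection has size exactly $\ell$. $g(n,k,\ell)$ is the minimum of $\alpha(\mathcal{H})$ over all $(n,k,\ell)$-omitting systems $\mathcal{H}$. *)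

(* Defs.v *)
From mathcomp Require Import all_boot all_order all_algebra.
From mathcomp Require Import reals exp.

Set Implicit Arguments.
Unset Strict Implicit.
Unset Printing Implicit Defensive.

Section Hypergraph.
Variable T : finType.
Implicit Types (H : {set {set T}}) (A : {set T}) (k l : nat).

Definition is_kgraph k H : bool := [forall e in H, #|e| == k].

Definition independent H A : bool := [forall e in H, ~~ (e \subset A)].

Definition alpha H : nat := \max_(A : {set T} | independent H A) #|A|.

Definition omitting_system k l H : bool :=
  is_kgraph k H &&
  [forall e in H, forall f in H, (e != f) ==> (#|e :&: f| != l)].

End Hypergraph.

(* [set0] is only the mandatory starting point of [arg min]: the edgeless graph
   is an omitting system, so the minimum is over a nonempty family (see
   [g_attained] and [g_le]). *)
Definition g (n k l : nat) : nat :=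
  alpha [arg min_(H < (set0 : {set {set 'I_n}}) | omitting_system k l H) alpha H].

Lemma omitting_system0 (T : finType) k l : omitting_system k l (set0 : {set {set T}}).
Proof. by apply/andP; split; apply/forall_inP => e; rewrite inE. Qed.

Lemma g_attained n k l :
  exists2 H : {set {set 'I_n}}, omitting_system k l H & alpha H = g n k l.
Proof. by rewrite /g; case: arg_minnP => [|H]; [exact: omitting_system0 | exists H]. Qed.

Lemma g_le n k l (H : {set {set 'I_n}}) : omitting_system k l H -> g n k l <= alpha H.
Proof. by rewrite /g; case: arg_minnP => [|H0 _ H0min]; [exact: omitting_system0 | exact: H0min]. Qed.

(* Main.v *)
Require Import Defs.
From mathcomp Require Import all_boot all_order all_algebra finfield.
From mathcomp Require Import reals sequences exp.
From mathcomp Require Import zify ring lra.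
Import Order.TTheory GRing.Theory Num.Theory.

(** Lower bound.  Call a vertex set extensible if it lies in edges avoiding any
    prescribed [k] vertices outside it.  The minimal extensible sets of size at
    least [2l+2] still omit the intersection size [l], and an independent set for
    them is independent for the hypergraph.  Order their vertices and pass to a
    positive fraction, as in Furedi's delta-system method, so that the position
    sets in which two of them can agree form an intersection-closed family [J]
    with no member of size [l] and none of size above [2l+1].  By the
    Frankl-Katona theorem some [l+1] positions lie in no member of [J], hence
    determine the set; there are thus [O(n^(l+1))] such sets, and a first-moment
    argument gives an independent set of order [n^((l+1)/(2l+1))], which dominates
    both terms of the maximum.

    Upper bound.  Over a field with [q] elements, graphs of polynomials of degree
    below [l] on [m = n/q] points are [q^l] blocks meeting pairwise in fewer than
    [l] points.  Choose a random [(l+1)]-set in each block and take all [k]-subsets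
    of the block containing it.  A set of [kq] points contains many [(l+1)]-sets
    in blocks that it meets in at least [k] points, and a union bound works as soon
    as [q^(2l)] exceeds [k n^(l+1) log n]. *)

Set Implicit Arguments.
Unset Strict Implicit.
Unset Printing Implicit Defensive.

(** * Exact weights and intersection-closed families *)

Lemma subset_of_card (T : finType) (A : {set T}) (n : nat) :
  n <= #|A| -> exists2 B : {set T}, B \subset A & #|B| = n.
Proof.
move=> nA; have : 0 < #|[set B : {set T} | B \subset A & #|B| == n]|.
  by rewrite cards_draws bin_gt0.
by case/card_gt0P=> B; rewrite inE => /andP[? /eqP]; exists B.
Qed.

(** Weight each related pair [(q, i)] by [1 / u q]. The weights sum to [#|V|], and raising each to
    [1 / v i] gives a sum of at most [#|P|]. *)
Lemma nonincidence_card (T I : finType) (r : T -> I -> bool)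
    (V : {set T}) (P : {set I}) :
  (forall q, q \in V -> 0 < #|[set i in P | r q i]|) ->
  (forall q i, q \in V -> i \in P -> r q i ->
     #|[set p in V | r p i]| <= #|[set j in P | r q j]|) ->
  #|V| <= #|P|.
Proof.
move=> u0 uv; rewrite -(ler_nat rat).
pose u q := #|[set i in P | r q i]|; pose v i := #|[set p in V | r p i]|.
have -> : (#|V|%:R = \sum_(q in V) \sum_(i in P | r q i) (u q)%:R^-1 :> rat)%R.
  rewrite -sum1_card natr_sum; apply: eq_bigr => q qV.
  rewrite sumr_const (_ : #|_| = u q); last by apply: eq_card => i; rewrite inE.
  by rewrite -[RHS]mulr_natl divff // pnatr_eq0 -lt0n u0.
apply: (@le_trans _ _ (\sum_(q in V) \sum_(i in P | r q i) (v i)%:R^-1)%R).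
  apply: ler_sum => q qV; apply: ler_sum => i /andP[iP rqi].
  have v0 : 0 < v i by apply/card_gt0P; exists q; rewrite inE qV.
  rewrite lef_pV2 ?posrE ?ltr0n ?ler_nat ?uv //.
  exact: leq_trans v0 (uv _ _ _ _ _).
rewrite (exchange_big_dep (mem P)) /=; last by move=> q i _ /andP[].
rewrite -sum1_card natr_sum; apply: ler_sum => i iP.
rewrite (eq_bigl (fun q => (q \in V) && r q i)); last by move=> q; rewrite iP.
rewrite sumr_const (_ : #|_| = v i); last by apply: eq_card => q; rewrite inE.
by case: (v i) => [|w]; rewrite ?mulr0n // -[leLHS]mulr_natl divff ?pnatr_eq0.
Qed.

(* Frankl-Katona theorem.  Unless some vertex lies in all sets, double counting
   gives [q] outside [A i] such that fewer sets miss [q] than points miss [A i];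
   put [A i] into [E], keep [q] out, and recurse. *)
Lemma exact_weight (T I : finType) (A : I -> {set T}) (t : nat)
    (V : {set T}) (P : {set I}) :
  #|P| <= t -> t < #|V| ->
  exists2 E : {set T}, E \subset V & #|E| + #|[set i in P | A i \subset E]| = t.
Proof.
elim/ltn_ind: t => t IH in A V P *; move=> Pt tV.
(* With exactly [t.+1] points, deleting a point common to all sets leaves weight exactly [t]. *)
have {tV} [V1 V1V V1c] := subset_of_card tV.
pose P1 := [set i in P | A i \subset V1].
have P1t : #|P1| <= t.
  by apply: leq_trans Pt; apply/subset_leq_card/subsetP=> i; rewrite inE => /andP[].
suff [E EV1 Et] : exists2 E : {set T}, E \subset V1 &
    #|E| + #|[set i in P1 | A i \subset E]| = t.
  exists E; first exact: subset_trans V1V.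
  rewrite -Et; congr (_ + _); apply: eq_card => i; rewrite !inE.
  by case: (boolP (A i \subset E)) => AE; rewrite ?andbF // (subset_trans AE EV1) !andbT.
pose u q := #|[set i in P1 | q \notin A i]|.
pose v i := #|[set q in V1 | q \notin A i]|.
case: (boolP [exists q in V1, u q == 0]) => [/existsP[q /andP[qV /eqP u0]]|u_gt0].
  exists (V1 :\ q); first exact: subsetDl.
  have -> : #|V1 :\ q| = t by have := cardsD1 q V1; rewrite qV V1c add1n => -[].
  rewrite -[RHS]addn0; congr (_ + _); apply/eqP; rewrite cards_eq0; apply/eqP/setP=> i.
  rewrite [in RHS]inE; apply/negbTE; rewrite inE; apply/negP=> /andP[iP1 /subsetP AiE].
  move/eqP: u0; rewrite cards_eq0 => /eqP/setP/(_ i); rewrite !inE in iP1 *.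
  rewrite iP1 /= => /negbFE/AiE; by rewrite !inE eqxx.
have [q [i [qV iP qAi uv]]] : exists q i, [/\ q \in V1, i \in P1, q \notin A i & u q < v i].
  case: (boolP [exists q in V1, exists i in P1, (q \notin A i) && (u q < v i)]).
    by move=> /existsP[q /andP[qV /existsP[i /andP[iP /andP[? ?]]]]]; exists q, i.
  move=> H; exfalso; suff : #|V1| <= #|P1| by rewrite V1c leqNgt ltnS P1t.
  apply: (@nonincidence_card _ _ (fun q i => q \notin A i)) => [q qV|q i qV iP qAi].
    by rewrite lt0n; move/existsPn: u_gt0 => /(_ q); rewrite qV.
  rewrite leqNgt; apply: contra H => uv.
  by apply/existsP; exists q; rewrite qV; apply/existsP; exists i; rewrite iP qAi.
pose x := A i; pose e := #|[set j in P1 | A j \subset x]|.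
pose P2 := [set j in P1 | (q \notin A j) && ~~ (A j \subset x)].
pose V2 := V1 :\: (q |: x).
have xV : x \subset V1 by move: iP; rewrite inE => /andP[].
have e_gt0 : 0 < e by apply/card_gt0P; exists i; rewrite inE iP subxx.
have vx : v i + #|x| = t.+1.
  rewrite -V1c -(cardsID x V1) (setIidPr xV) addnC; congr (_ + _).
  by apply: eq_card => p; rewrite !inE andbC.
have ux : u q = #|P2| + e.
  rewrite /u -(cardsID [set j | A j \subset x]) addnC; congr (_ + _).
    by apply: eq_card => j; rewrite !inE -!andbA andbCA; do !bool_congr.
  apply: eq_card => j; rewrite !inE -!andbA; do 2!congr (_ && _).
  case: (boolP (A j \subset x)) => Ajx; rewrite ?andbF // andbT.
  by apply: contra qAi => /(subsetP Ajx).
have V2c : #|V2| = t - #|x|.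
  have qx : q |: x \subset V1 by rewrite subUset sub1set qV.
  have := cardsID (q |: x) V1; rewrite (setIidPr qx) cardsU1 (negbTE (qAi : q \notin x)) V1c.
  rewrite -/V2; lia.
(* The points of [x] and the [e] sets inside it already count towards [t]. Since [u q < v i], the
   family [P2] has at most [t - #|x| - e] sets, and [e_gt0] leaves [V2] with more points than
   that. *)
have [||| E2 E2V E2t] := IH (t - #|x| - e) _ (fun j => A j :\: x) V2 P2; [lia|lia|lia|].
have E2x : [disjoint E2 & x].
  rewrite disjoint_subset; apply/subsetP=> p /(subsetP E2V); rewrite !inE negb_or.
  by case/andP=> /andP[].
have qE : q \notin E2 :|: x.
  rewrite inE negb_or qAi andbT; apply/negP => /(subsetP E2V); by rewrite !inE eqxx.
exists (E2 :|: x).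
  by rewrite subUset xV andbT (subset_trans E2V) ?subsetDl.
rewrite -(cardsID [set j | A j \subset x]).
have -> : #|[set j in P1 | A j \subset E2 :|: x] :&: [set j | A j \subset x]| = e.
  apply: eq_card => j; rewrite !inE -!andbA; do 2!congr (_ && _).
  by case: (boolP (A j \subset x)) => Ajx; rewrite ?andbF // (subset_trans Ajx) ?subsetUr.
have -> : #|[set j in P1 | A j \subset E2 :|: x] :\: [set j | A j \subset x]| =
          #|[set j in P2 | A j :\: x \subset E2]|.
  apply: eq_card => j; rewrite !inE subDset [x :|: E2]setUC.
  case: (boolP (A j \subset E2 :|: x)) => AE; last by rewrite !andbF.
  rewrite (contra (subsetP AE q) qE).
  by case: (A j \subset x); rewrite /= ?andbF ?andbT.
move: E2t; rewrite cardsU (disjoint_setI0 E2x) cards0; lia.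
Qed.

(* Take [l+2] points of a minimal uncovered set [M0] and members [C y] of [J]
   covering [M0 :\ y]; by [exact_weight] some of the [C y] meet in [l] points. *)
Lemma uncovered_set (I : finType) (J : {set {set I}}) (l : nat) :
  (forall A B, A \in J -> B \in J -> A :&: B \in J) ->
  [set: I] \notin J ->
  (forall A, A \in J -> #|A| <= 2 * l + 1) ->
  (forall A, A \in J -> #|A| != l) ->
  exists2 P : {set I}, #|P| <= l.+1 & forall A, A \in J -> ~~ (P \subset A).
Proof.
move=> JI JT Jle Jne.
pose unc (P : {set I}) := [forall A in J, ~~ (P \subset A)].
have uncT : unc [set: I].
  by apply/forall_inP=> A AJ; rewrite subTset; apply: contra JT => /eqP <-.
have [M0 /minsetP[uncM M0min] _] := minset_exists uncT.
case: (leqP #|M0| l.+1) => [M0le|M0gt]; first by exists M0 => //; apply/forall_inP.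
exfalso.
have C_ex y : {C : {set I} | y \in M0 -> [/\ C \in J, M0 :\ y \subset C & y \notin C]}.
  case: (boolP [exists C in J, (M0 :\ y \subset C) && (y \notin C)]) => [H|H].
    by exists (xchoose (existsP H)) => _; case/andP: (xchooseP (existsP H)) => ? /andP[].
  exists set0 => yM; exfalso; move/negP: H; apply.
  have : ~~ unc (M0 :\ y).
    apply/negP=> /M0min/(_ (subD1set _ _))/setP/(_ y).
    by rewrite !inE eqxx yM.
  case/forall_inPn=> C CJ /negbNE MC; apply/existsP; exists C; rewrite CJ MC /=.
  apply/negP=> yC; move/forall_inP/(_ _ CJ)/negP: uncM; apply.
  by rewrite -(setD1K yM) subUset sub1set yC.
pose C y := sval (C_ex y).
have CP y : y \in M0 -> [/\ C y \in J, M0 :\ y \subset C y & y \notin C y] := svalP (C_ex y).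
have [M MM0 Mc] := subset_of_card M0gt.
have [y0 y0M] : exists y, y \in M by apply/card_gt0P; rewrite Mc.
have {}CP y : y \in M -> [/\ C y \in J, M :\ y \subset C y & y \notin C y].
  move=> yM; have [? MC ?] := CP y (subsetP MM0 _ yM); split => //.
  exact: subset_trans (setSD _ MM0) MC.
(* At most [l] points, as [C y0] has at most [2 * l + 1] and [l.+1] of them lie in [M]. *)
pose phi := C y0 :\: M.
have [C0J MC0 y0C0] := CP _ y0M.
have My0c : #|M :\ y0| = l.+1 by have := cardsD1 y0 M; rewrite y0M Mc add1n => -[].
have phile : #|phi| <= l.
  have := cardsID M (C y0); have := Jle _ C0J.
  have : #|M :\ y0| <= #|C y0 :&: M|.
    by apply: subset_leq_card; rewrite subsetI MC0 subD1set.
  rewrite -/phi; lia.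
(* Intersect [C y0] with the [C y] for [y] in [M :\ y0] outside [E]. Each [C y] misses exactly [y]
   in [M], so the part in [M] is [E]. A point [x] of [phi] survives exactly when every [y] in
   [M :\ y0] with [x \notin C y] lies in [E]. *)
have [|E EV Et] := @exact_weight I I (fun x => [set y in M :\ y0 | x \notin C y]) l (M :\ y0) phi phile.
  by rewrite My0c.
pose K := C y0 :&: \bigcap_(y in (M :\ y0) :\: E) C y.
have KJ : K \in J.
  rewrite /K; elim/big_rec: _ => [|y D yM DJ]; first by rewrite setIT.
  rewrite setICA; apply: JI => //; move: yM; rewrite !inE => /and3P[_ _ yM].
  by case: (CP _ yM).
move: (Jne _ KJ); rewrite -Et => /eqP; apply.
rewrite -(cardsID M); congr (_ + _).
  apply: eq_card => x; rewrite !inE; apply/andP/idP.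
    case=> /andP[xC0 /bigcapP xC] xM; apply/negPn/negP=> xE.
    case: (eqVneq x y0) => [xy0|xy0]; first by case/negP: y0C0; rewrite -{1}xy0.
    have := xC x; rewrite !inE xE xy0 xM => /(_ isT).
    by apply/negP; case: (CP _ xM).
  move=> xE; have := subsetP EV _ xE; rewrite !inE => /andP[xy0 xM].
  split=> //; rewrite (subsetP MC0) ?inE ?xy0 //=; apply/bigcapP=> y.
  rewrite !inE => /and3P[yE yy0 yM]; have [_ /subsetP MC _] := CP _ yM.
  apply: MC; rewrite !inE xM andbT; by apply: contra yE => /eqP <-.
apply: eq_card => x; rewrite !inE -!andbA; congr (_ && _); congr (_ && _).
apply/bigcapP/subsetP=> [H y|H y].
  rewrite !inE => /andP[/andP[yy0 yM] xC]; apply/negPn/negP=> yE.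
  by have := H y; rewrite !inE yE yy0 yM (negbTE xC) => /(_ isT).
rewrite !inE => /andP[yE yM]; apply/negPn/negP => xC.
by have := H y; rewrite !inE yM xC (negbTE yE) => /(_ isT).
Qed.

(** * Homogeneous subfamilies *)

Definition agree (I V : finType) (F G : {ffun I -> V}) : {set I} :=
  [set i | F i == G i].

(** Replaces a large sunflower with kernel [F] on [A]: instead of disjoint petals, members that
    avoid any small [W] off [A] are available on demand. *)
Definition rich (I V : finType) (w : nat) (H : {set {ffun I -> V}})
    (A : {set I}) (F : {ffun I -> V}) : bool :=
  [forall W : {set V}, (#|W| <= w) ==>
     [exists G in H, (A \subset agree F G) && [forall i, (i \in A) || (G i \notin W)]]].

Lemma richP (I V : finType) (w : nat) (H : {set {ffun I -> V}})
    (A : {set I}) (F : {ffun I -> V}) :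
  reflect (forall W : {set V}, #|W| <= w ->
             exists G, [/\ G \in H, A \subset agree F G &
                          forall i, i \notin A -> G i \notin W])
          (rich w H A F).
Proof.
apply: (iffP forall_inP) => [rH W /rH/existsP[G /and3P[GH FG /forallP GW]]|rH W /rH].
  by exists G; split=> // i iA; have := GW i; rewrite (negbTE iA).
case=> G [GH FG GW]; apply/existsP; exists G; rewrite GH FG; apply/forallP => i.
by case: (boolP (i \in A)) => // /GW.
Qed.

Lemma richS (I V : finType) (w : nat) (H K : {set {ffun I -> V}})
    (A : {set I}) (F : {ffun I -> V}) :
  K \subset H -> rich w K A F -> rich w H A F.
Proof.
move=> /subsetP KH /richP rK; apply/richP=> W /rK[G [GK FG GW]].
by exists G; split=> //; apply: KH.
Qed.

Lemma agree_trans (I V : finType) (A : {set I}) (F G K : {ffun I -> V}) :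
  A \subset agree F G -> A \subset agree F K -> A \subset agree G K.
Proof.
move=> /subsetP FG /subsetP FK; apply/subsetP=> i iA.
by move: (FG i iA) (FK i iA); rewrite !inE => /eqP <-.
Qed.

Lemma rich_agree (I V : finType) (w : nat) (H : {set {ffun I -> V}})
    (A : {set I}) (F G : {ffun I -> V}) :
  A \subset agree F G -> rich w H A F -> rich w H A G.
Proof.
move=> FG /richP rF; apply/richP=> W /rF[K [KH FK KW]].
by exists K; split=> //; apply: agree_trans FK.
Qed.

(* Edges violating stability are deleted one at a time and labelled by the
   violated position set; an edge is deleted while all edges deleted after it
   are still present, hence no label class has a rich trace at its label. *)
Lemma stable_core (I V : finType) (w : nat) (N : {set {set I}})
    (H : {set {ffun I -> V}}) :
  exists (K : {set {ffun I -> V}}) (lab : {ffun I -> V} -> {set I}),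
    [/\ K \subset H,
        forall F A, F \in K -> A \notin N -> rich w K A F,
        forall F, F \in H :\: K -> lab F \notin N &
        forall F, F \in H :\: K ->
          ~~ rich w [set G in H :\: K | lab G == lab F] (lab F) F].
Proof.
have [n] := ubnP #|H|; elim: n H => // n IH H Hn.
case: (boolP [forall F in H, forall A in ~: N, rich w H A F]) => [/forall_inP st|].
  exists H, (fun=> set0); split=> // [F A FH AN|F|F]; last 2 first.
  - by rewrite setDv inE.
  - by rewrite setDv inE.
  by move/forall_inP: (st _ FH); apply; rewrite inE.
case/forall_inPn=> F FH /forall_inPn[A AN FnA]; rewrite inE in AN.
have [|K [lab [KH Kst labN labP]]] := IH (H :\ F).
  by move: Hn; rewrite (cardsD1 F H) FH; lia.
have FK : F \notin K by apply/negP=> /(subsetP KH); rewrite !inE eqxx.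
exists K, (fun G => if G == F then A else lab G); split=> //.
- exact: subset_trans KH (subD1set _ _).
- move=> G; rewrite !inE => /andP[GK GH]; case: eqP => // /eqP GF.
  by apply: labN; rewrite !inE GK GF.
move=> G; rewrite !inE => /andP[GK GH].
set D := [set G0 in _ | _].
have DH : D \subset H by apply/subsetP=> G'; rewrite !inE => /andP[/andP[]].
case: eqP => [->|/eqP GF]; first by apply: contra FnA; apply: richS.
(* If [G] has label [A] and agrees with [F] there, richness passes to [F], contradicting [FnA].
   Otherwise [F] is never a witness for [G], so the class without [F] is already rich, contradicting
   [labP]. *)
apply/negP=> rG; case: (boolP ((A == lab G) && (A \subset agree G F))).
  case/andP=> /eqP AG GFA; move/negP: FnA; apply; apply: richS DH _.
  by apply: rich_agree GFA _; rewrite AG.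
move=> nFG; have GHK : G \in (H :\ F) :\: K by rewrite !inE GK GF.
move/negP: (labP _ GHK); apply; apply/richP=> W /(richP _ _ _ _ rG)[G' [G'D GG' G'W]].
exists G'; split=> //; move: G'D; rewrite !inE (negbTE GF).
case: (G' =P F) => [G'F|_ /andP[/andP[-> ->] ->] //].
by case/andP=> _ AG; case/negP: nFG; rewrite AG (eqP AG) -G'F.
Qed.

Lemma card_fibres (T S : finType) (f : T -> S) (D : {set T}) :
  #|D| = \sum_y #|[set x in D | f x == y]|.
Proof.
rewrite -sum1_card (partition_big f predT) //=; apply: eq_bigr => y _.
by rewrite -sum1_card; apply: eq_bigl => x; rewrite inE.
Qed.

(* If the traces on [A] are not rich, all edges with a given trace meet a small
   set outside [A]; keep only those through a most popular vertex of that set. *)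
Lemma prune (I V : finType) (w : nat) (D : {set {ffun I -> V}}) (A : {set I}) :
  (forall F, F \in D -> ~~ rich w D A F) ->
  exists D' : {set {ffun I -> V}},
    [/\ D' \subset D, #|D| <= (#|I| * w).+1 * #|D'| &
        forall F G, F \in D' -> G \in D' -> F != G -> agree F G != A].
Proof.
move=> nrich; set c := (#|I| * w).+1.
pose res (F : {ffun I -> V}) := [ffun i => if i \in A then Some (F i) else None].
have resP F G : (res F == res G) = (A \subset agree F G).
  apply/eqP/subsetP=> [FG i iA|FG].
    by move/ffunP/(_ i): FG; rewrite !ffunE iA inE => -[->].
  apply/ffunP=> i; rewrite !ffunE; case: ifP => // /FG.
  by rewrite inE => /eqP ->.
pose fib rho := [set G in D | res G == rho].
pose sub rho (bx : I * V) := [set G in fib rho | G bx.1 == bx.2].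
(* Every edge of a fibre passes through one of at most [#|I| * w < c] position-vertex pairs outside
   [A], so some pair carries a [1/c] share of the fibre. *)
pose sel rho := [pick bx : I * V | (bx.1 \notin A) && (#|fib rho| <= c * #|sub rho bx|)].
pose D' := [set G in D | if sel (res G) is Some bx then G bx.1 == bx.2 else false].
exists D'; split.
- by apply/subsetP=> G; rewrite inE => /andP[].
- rewrite (card_fibres res D) (card_fibres res D') big_distrr /=.
  apply: leq_sum => rho _; rewrite -/(fib rho).
  have [->|[F]] := set_0Vmem (fib rho); first by rewrite cards0.
  rewrite inE => /andP[FD /eqP Frho].
  have [bx selE /andP[bA le_sub]] : exists2 bx, sel rho = Some bx &
      (bx.1 \notin A) && (#|fib rho| <= c * #|sub rho bx|).
    rewrite /sel; case: pickP => [bx bxP|nopick]; first by exists bx.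
    exfalso; have /forall_inPn[W Ww /existsPn noG] := nrich _ FD.
    pose S := setX (~: A) W.
    have Sc : #|S| < c.
      by rewrite cardsX ltnS leq_mul // max_card.
    have le_fib : #|fib rho| <= \sum_(bx in S) #|sub rho bx|.
      rewrite -sum1_card.
      under [X in _ <= X]eq_bigr => bx _ do rewrite -sum1_card.
      rewrite (exchange_big_dep (mem (fib rho))) /=; last first.
        by move=> bx G _; rewrite inE => /andP[].
      apply: leq_sum => G; rewrite inE => /andP[GD /eqP Grho].
      move: (noG G); rewrite GD -resP Frho Grho eqxx /= => /forallPn[i].
      rewrite negb_or negbK => /andP[iA GiW].
      by rewrite (bigD1 (i, G i)) //= !inE /= iA GiW GD Grho !eqxx.
    have fib_gt0 : 0 < #|fib rho| by apply/card_gt0P; exists F; rewrite inE FD Frho eqxx.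
    have : c * #|fib rho| <= #|S| * #|fib rho|.
      apply: (@leq_trans (c * \sum_(bx in S) #|sub rho bx|)); first by rewrite leq_mul2l le_fib orbT.
      rewrite big_distrr /= -sum_nat_const; apply: leq_sum => bx.
      rewrite !inE => /andP[bA _]; have := nopick bx; rewrite bA /= => /negbT.
      by rewrite -ltnNge => /ltnW.
    by rewrite leq_pmul2r // leqNgt Sc.
  apply: (leq_trans le_sub); rewrite leq_mul2l; apply/orP; right.
  apply/subset_leq_card/subsetP=> G; rewrite !inE => /andP[/andP[-> /eqP Grho] Gb].
  by rewrite Grho selE Gb eqxx.
move=> F G; rewrite !inE => /andP[FD Fs] /andP[GD Gs] FG.
(* Equal traces select the same pair [bx], which forces an agreement outside [A]. *)
apply/eqP=> FGA; have/eqP rFG : res F == res G by rewrite resP FGA.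
move: Fs Gs; rewrite -rFG; rewrite /sel; case: pickP => // bx /andP[bA _] /eqP Fb /eqP Gb.
by case/negP: bA; rewrite -FGA inE Fb Gb.
Qed.

(** Either the stable core keeps a [1/m] share of [H], or by pigeonhole one of the [2 ^ #|I|] label
    classes does. Pruning that class forbids its label as an agreement set, so [N] grows, and this
    happens at most [j] times. *)
Lemma homogeneous_subfamily_rec (I V : finType) (w j : nat) (N : {set {set I}})
    (H : {set {ffun I -> V}}) :
  #|~: N| <= j ->
  (forall F G, F \in H -> G \in H -> F != G -> agree F G \notin N) ->
  exists (K : {set {ffun I -> V}}) (M : {set {set I}}),
    [/\ K \subset H, N \subset M,
        #|H| <= (2 ^ #|I|).+1 * ((2 ^ #|I|).+1 * (#|I| * w).+1) ^ j * #|K|,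
        forall F G, F \in K -> G \in K -> F != G -> agree F G \notin M &
        forall F A, F \in K -> A \notin M -> rich w K A F].
Proof.
set m := (2 ^ #|I|).+1; set c := (#|I| * w).+1.
elim: j => [|j IH] in N H *; move=> Nj HN; have [K [lab [KH Kst labN labP]]] := stable_core w N H;
  (have [HK|HK] := leqP #|H| (m * #|K|);
   first by exists K, N; split=> // [|F G FK GK]; [
     apply: leq_trans HK _; rewrite leq_mul2r leq_pmulr ?orbT ?expn_gt0 ?muln_gt0 //
   | apply: HN; apply: (subsetP KH)]).
  exfalso; move: HK; suff -> : H = K by rewrite mulSn; lia.
  apply/eqP; rewrite eqEsubset KH andbT; apply/subsetP=> F FH; apply/negPn/negP=> FK.
  have := labN F; rewrite !inE FK FH => /(_ isT) lN.
  by move: Nj; rewrite leqNgt; case/negP; apply/card_gt0P; exists (lab F); rewrite inE.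
pose D A := [set F in H :\: K | lab F == A].
have [A HA] : exists A, #|H| <= m * #|D A|.
  apply/existsP; apply: contraT => /existsPn noA.
  have : m * #|H| < m * #|H|; last by rewrite ltnn.
  have {1}-> : #|H| = #|K| + \sum_A #|D A|.
    by rewrite -(cardsID K H) (setIidPr KH) -card_fibres.
  rewrite mulnDr {3}/m mulSn -addSn leq_add //.
  rewrite big_distrr /= -cardsT -card_powerset.
  have -> : powerset [set: I] = [set: {set I}] by apply/setP=> B; rewrite !inE subsetT.
  rewrite cardsT -sum_nat_const; apply: leq_sum => A _.
  by have := noA A; rewrite -ltnNge => /ltnW.
have DA0 : 0 < #|D A|.
  by rewrite lt0n; apply/eqP=> D0; move: HA HK; rewrite D0; lia.
have [F0] := card_gt0P DA0; rewrite inE => /andP[F0H /eqP F0A].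
have AN : A \notin N by rewrite -F0A labN.
have [F FD|D' [D'D DD' D'A]] := @prune I V w (D A) A.
  by move: FD; rewrite inE => /andP[FH /eqP <-]; apply: labP.
have D'H : D' \subset H.
  by apply: subset_trans D'D _; apply/subsetP=> F; rewrite !inE => /andP[/andP[]].
have [||L [M [LD' NM D'L Lsep Lrich]]] := IH (A |: N) D'.
- move: Nj; rewrite (cardsD1 A) inE AN add1n ltnS; congr (_ <= _); apply: eq_card => B.
  by rewrite !inE negb_or.
- move=> F G FD GD FG; rewrite !inE negb_or D'A //=.
  by apply: HN => //; apply: (subsetP D'H).
exists L, M; split=> //.
- exact: subset_trans D'H.
- exact: subset_trans (subsetUr _ _) NM.
apply: (leq_trans HA); rewrite expnS -!mulnA leq_mul2l; apply/orP; right.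
apply: (leq_trans DD'); rewrite [X in _ <= X]mulnCA leq_mul2l; apply/orP; right.
by rewrite mulnA.
Qed.

(** The loss in [homogeneous_subfamily_rec] for [q] positions and the maximal number [2 ^ q] of
    rounds. *)
Definition sparsity (q w : nat) : nat :=
  (2 ^ q).+1 * ((2 ^ q).+1 * (q * w).+1) ^ (2 ^ q).

Lemma homogeneous_subfamily (I V : finType) (w : nat) (H : {set {ffun I -> V}}) :
  exists (K : {set {ffun I -> V}}) (M : {set {set I}}),
    [/\ K \subset H, [set: I] \in M, #|H| <= sparsity #|I| w * #|K|,
        forall F G, F \in K -> G \in K -> F != G -> agree F G \notin M &
        forall F A, F \in K -> A \notin M -> rich w K A F].
Proof.
have [||K [M [KH NM HK sep ri]]] := @homogeneous_subfamily_rec I V w (2 ^ #|I|) [set [set: I]] H.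
- apply: (@leq_trans #|[set: {set I}]|); first exact: subset_leq_card (subsetT _).
  have <- : powerset [set: I] = [set: {set I}] by apply/setP=> B; rewrite !inE subsetT.
  by rewrite card_powerset cardsT.
- move=> F G _ _ FG; rewrite inE; apply: contra FG => /eqP/setP FG.
  by apply/eqP/ffunP=> i; have := FG i; rewrite !inE => /eqP.
exists K, M; split=> //; by rewrite -sub1set.
Qed.

(** [uncovered_set] applies to [~: M], which contains all agreement sets of distinct members of [K].
    Hence restriction to the resulting [P] is injective on [K]. *)
Lemma sparse_family (I V : finType) (l w : nat) (H : {set {ffun I -> V}}) :
  #|I| <= w -> l < #|I| -> 0 < #|V| ->
  (forall F, F \in H -> injective F) ->
  (forall F G, F \in H -> G \in H -> F != G ->
     #|[set F i | i : I] :&: [set G i | i : I]| != l) ->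
  (forall F A, F \in H -> A != [set: I] -> rich w H A F -> #|A| <= 2 * l + 1) ->
  #|H| <= sparsity #|I| w * #|V| ^ l.+1.
Proof.
move=> Iw lI V0 Hinj Homit Hrich.
have [K [M [KH TM HK sep ri]]] := homogeneous_subfamily w H.
apply: (leq_trans HK); rewrite leq_mul2l; apply/orP; right.
have [->|[F FK]] := set_0Vmem K; first by rewrite cards0.
have imw (G : {ffun I -> V}) : #|[set G i | i : I]| <= w.
  exact: leq_trans (leq_imset_card _ _) Iw.
have in_im (G : {ffun I -> V}) i : G i \in [set G i | i : I] by apply: imset_f.
have FH := subsetP KH _ FK.
have [||||P Pl Punc] := @uncovered_set I (~: M) l.
- move=> A B; rewrite !inE => AM BM.
  (* [F'] leaves the image of [F] off [A], and [G'] leaves the image of [F'] off [B], so the two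
     agree exactly on [A :&: B]. *)
  have [F' [F'K FF' F'W]] := richP _ _ _ _ (ri _ _ FK AM) _ (imw F).
  have [G' [G'K FG' G'W]] := richP _ _ _ _ (ri _ _ FK BM) _ (imw F').
  have AT : A != [set: I] by apply: contra AM => /eqP ->.
  have <- : agree F' G' = A :&: B.
    apply/setP=> i; rewrite !inE; apply/eqP/andP=> [E|[iA iB]].
      have iB : i \in B by apply/negPn/negP => /G'W; rewrite -E in_im.
      split=> //; apply/negPn/negP => /F'W; rewrite E.
      by move/subsetP/(_ _ iB): FG'; rewrite inE => /eqP <-; rewrite in_im.
    move/subsetP/(_ _ iA): FF'; move/subsetP/(_ _ iB): FG'.
    by rewrite !inE => /eqP <- /eqP <-.
  apply: sep => //; apply: contra AT => /eqP E; apply/eqP/setP=> i; rewrite inE.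
  apply/negPn/negP=> iA; case: (boolP (i \in B)) => iB; last first.
    by have := G'W _ iB; rewrite -E in_im.
  have := F'W _ iA; move/subsetP/(_ _ iB): FG'; rewrite inE E => /eqP <-.
  by rewrite in_im.
- by rewrite inE negbK.
- move=> A; rewrite inE => AM; apply: Hrich FH _ (richS KH (ri _ _ FK AM)).
  by apply: contra AM => /eqP ->.
- move=> A; rewrite inE => AM; apply/negP=> /eqP Al.
  (* [G] avoids the image of [F] off [A], so the two images would share exactly the [l] vertices
     over [A]. *)
  have [G [GK FG GW]] := richP _ _ _ _ (ri _ _ FK AM) _ (imw F).
  have [i iA] : exists i, i \notin A.
    apply/existsP; rewrite -negb_forall; apply/negP=> /forallP AT.
    by move: lI; rewrite -Al -cardsT ltnNge subset_leq_card //; apply/subsetP=> i.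
  have FneG : F != G by apply/negP=> /eqP E; have := GW _ iA; rewrite E in_im.
  move/negP: (Homit _ _ FH (subsetP KH _ GK) FneG); apply.
  rewrite -Al -(card_imset _ (Hinj _ FH)); apply/eqP; apply: eq_card => v.
  rewrite !inE; apply/andP/imsetP=> [[/imsetP[j _ vF] /imsetP[i' _ vG]]|[j jA ->]].
    exists j => //; have i'A : i' \in A.
      by apply/negPn/negP => /GW; rewrite -vG vF in_im.
    move/subsetP/(_ _ i'A): FG; rewrite inE -vG vF => /eqP/(Hinj _ FH) <- //.
  rewrite in_im; split=> //; move/subsetP/(_ _ jA): FG; rewrite inE => /eqP ->.
  by rewrite in_im.
pose tr (G : {ffun I -> V}) := [ffun j : {i | i \in P} => G (val j)].
have tr_inj : {in K &, injective tr}.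
  move=> G G' GK G'K E; apply/eqP/negPn/negP=> GG'.
  have := Punc (agree G G'); rewrite inE sep // => /(_ isT)/negP; apply.
  apply/subsetP=> i iP; move/ffunP/(_ (exist _ i iP)): E; rewrite !ffunE /= inE.
  by move/eqP.
rewrite -(card_in_imset tr_inj); apply: leq_trans (max_card _) _.
by rewrite card_ffun card_sig leq_pexp2l.
Qed.

(** * Minimal extensible sets *)

Lemma prod_nat_of_bool (T : finType) (P : pred T) :
  \prod_x nat_of_bool (P x) = [forall x, P x].
Proof.
case: (boolP [forall x, P x]) => [/forallP allP|/forallPn[x /negbTE Px]].
  by rewrite big1 // => x _; rewrite allP.
by rewrite (bigD1 x) //= Px.
Qed.

(** Division-free form of a probability: a uniform colouring gives all of [S] the colour [ord0] with
    probability [r.+1 ^- #|S|]. *)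
Lemma sum_ffun_zero_on (V : finType) (r : nat) (S : {set V}) :
  (\sum_(f : {ffun V -> 'I_r.+1}) (S \subset [set x | f x == ord0])) * r.+1 ^ #|S|
  = r.+1 ^ #|V|.
Proof.
have -> : \sum_(f : {ffun V -> 'I_r.+1}) (S \subset [set x | f x == ord0])
        = \sum_(f : {ffun V -> 'I_r.+1}) \prod_x nat_of_bool ((x \in S) ==> (f x == ord0)).
  apply: eq_bigr => f _; rewrite (prod_nat_of_bool (fun x => (x \in S) ==> (f x == ord0))).
  congr nat_of_bool; apply/subsetP/forall_inP=> Sf x xS; have := Sf x xS; by rewrite inE.
rewrite -(bigA_distr_bigA (fun x c => nat_of_bool ((x \in S) ==> (c == ord0)))).
rewrite (bigID (mem S)) /= big1 ?mul1n => [|x xS]; last first.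
  rewrite (bigD1 ord0) //= xS eqxx /= big1 // => c /negbTE c0; by rewrite c0.
rewrite (eq_bigr (fun=> r.+1)) => [|x /negbTE xS]; last first.
  rewrite (eq_bigr (fun=> 1)) ?sum1_card ?card_ord // => c _; by rewrite xS.
rewrite prod_nat_const -expnD -(cardC (mem S)) addnC; congr (_ ^ (_ + _)).
Qed.

(* First moment: colour the vertices with [r.+1] colours and delete one vertex
   from every edge inside the first colour class. *)
Lemma sparse_independent (V : finType) (B : {set {set V}}) (a r : nat) :
  (forall S, S \in B -> a < #|S|) ->
  exists2 U : {set V}, independent B U &
    #|V| * r.+1 ^ a <= #|U| * r.+1 ^ a.+1 + #|B|.
Proof.
move=> Ba; set R := r.+1; pose Z (f : {ffun V -> 'I_r.+1}) := [set x | f x == ord0].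
pose ins f := \sum_(S in B) (S \subset Z f).
(* Averaging over [f]: [#|Z f|] has mean [#|V| / R], and [ins f] has mean at most [#|B| / R ^ a.+1]
   since members of [B] have more than [a] points. *)
have [f fle] : exists f, #|V| * R ^ a + R ^ a.+1 * ins f <= #|Z f| * R ^ a.+1 + #|B|.
  apply/existsP; apply: contraT => /existsPn nof.
  have : \sum_(f : {ffun V -> 'I_r.+1}) (#|V| * R ^ a + R ^ a.+1 * ins f) <=
         \sum_(f : {ffun V -> 'I_r.+1}) (#|Z f| * R ^ a.+1 + #|B|).
    rewrite !big_split /= !sum_nat_const card_ffun card_ord -big_distrl -big_distrr /=.
    apply: leq_add.
      rewrite (eq_bigr (fun f => \sum_x ([set x] \subset Z f))); last first.
        move=> f _; rewrite -sum1_card big_mkcond; apply: eq_bigr => x _.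
        by rewrite sub1set; case: (_ \in _).
      rewrite exchange_big /= big_distrl /= -/R.
      rewrite (eq_bigr (fun=> R ^ #|V| * R ^ a)) ?sum_nat_const; first by rewrite mulnCA.
      by move=> x _; rewrite expnS mulnA -(sum_ffun_zero_on r [set x]) cards1 expn1.
    rewrite exchange_big /= -[#|B|]sum1_card !big_distrr /=; apply: leq_sum => S SB.
    rewrite muln1 -(sum_ffun_zero_on r S) mulnC leq_mul2l; apply/orP; right.
    by rewrite leq_pexp2l // Ba.
  rewrite leqNgt => /negP; case; rewrite (bigD1 [ffun=> ord0]) //= [X in _ < X](bigD1 [ffun=> ord0]) //=.
  rewrite -addSn; apply: leq_add; first by rewrite ltnNge nof.
  by apply: leq_sum => f _; rewrite ltnW // ltnNge nof.
pose bad := [set S in B | S \subset Z f].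
have insE : ins f = #|bad|.
  rewrite /ins -sum1_card big_mkcond [RHS]big_mkcond; apply: eq_bigr => S _.
  by rewrite inE; case: (S \in B) => //=; case: (_ \subset _).
pose pt (S : {set V}) := if [pick x in S] is Some x then [set x] else set0.
pose U := Z f :\: \bigcup_(S in bad) pt S.
exists U.
  apply/forall_inP=> S SB; apply/negP=> SU.
  have Sbad : S \in bad.
    by rewrite inE SB; apply: subset_trans SU (subsetDl _ _).
  have : exists2 x, x \in S & x \in pt S.
    rewrite /pt; case: pickP => [x xS|S0]; first by exists x; rewrite ?inE.
    by have := Ba _ SB; rewrite (eq_card0 S0).
  case=> x xS xpt; have := subsetP SU _ xS; rewrite inE => /andP[/negP[]];
  by apply/bigcupP; exists S.
have Ule : #|Z f| <= #|U| + ins f.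
  rewrite -(cardsID (\bigcup_(S in bad) pt S) (Z f)) addnC leq_add2l insE.
  apply: leq_trans (subset_leq_card (subsetIr _ _)) _.
  apply: (@leq_trans (\sum_(S in bad) #|pt S|)).
    elim/big_rec2: _ => [|S m A _ Am]; first by rewrite cards0.
    by rewrite cardsU; lia.
  rewrite -sum1_card; apply: leq_sum => S _; rewrite /pt.
  by case: pickP => *; rewrite ?cards1 ?cards0.
have : #|Z f| * R ^ a.+1 <= (#|U| + ins f) * R ^ a.+1 by rewrite leq_mul2r Ule orbT.
by move: fle; nia.
Qed.

(* Extensible sets play the role of kernels of large sunflowers. *)
Definition extensible (V : finType) (k : nat) (H : {set {set V}}) (S : {set V}) : bool :=
  [forall W : {set V}, (#|W| <= k) ==> [exists e in H, (S \subset e) && (e :&: W \subset S)]].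

Lemma extensibleP (V : finType) (k : nat) (H : {set {set V}}) (S : {set V}) :
  reflect (forall W : {set V}, #|W| <= k ->
             exists e, [/\ e \in H, S \subset e & e :&: W \subset S])
          (extensible k H S).
Proof.
apply: (iffP forall_inP) => [HS W /HS/existsP[e /and3P[]]|HS W /HS[e [*]]].
  by exists e.
by apply/existsP; exists e; apply/and3P.
Qed.

Definition minimal_extensible (V : finType) (k a : nat) (H : {set {set V}}) : {set {set V}} :=
  [set S | minset (fun S => (a <= #|S|) && extensible k H S) S].

(** Extend [S] to an edge [e] avoiding [S'] outside [S], then [S'] to an edge [f] avoiding [e]
    outside [S']. Then [e :&: f = S :&: S'], and [e] and [f] differ because [l < k]. *)
Lemma extensible_omitting (V : finType) (k l : nat) (H : {set {set V}}) (S S' : {set V}) :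
  omitting_system k l H -> l < k -> extensible k H S -> extensible k H S' ->
  #|S| <= k -> #|S'| <= k -> #|S :&: S'| != l.
Proof.
case/andP=> /forall_inP Hk /forall_inP Hl lk /extensibleP xS /extensibleP xS' Sk S'k.
have [e [eH Se eS']] := xS _ S'k.
have ek : #|e| <= k by rewrite (eqP (Hk _ eH)).
have [f [fH S'f fe]] := xS' _ ek.
have efE : e :&: f = S :&: S'.
  apply/setP=> x; rewrite !inE; apply/andP/andP=> [[xe xf]|[xS0 xS'0]].
    have xS'0 : x \in S' by apply: (subsetP fe); rewrite inE xf.
    by split=> //; apply: (subsetP eS'); rewrite inE xe.
  by split; [apply: (subsetP Se)|apply: (subsetP S'f)].
apply/negP=> /eqP Sl; have ef : e != f.
  apply: contraTneq lk => ef; rewrite -leqNgt -Sl -efE -ef setIid (eqP (Hk _ eH)) //.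
by have /forall_inP/(_ _ fH) := Hl _ eH; rewrite ef efE Sl eqxx.
Qed.

(** For each size [q], the injective enumerations of the minimal sets form a family to which
    [sparse_family] applies. Minimality supplies its bound on rich position sets. *)
Lemma card_minimal_extensible (V : finType) (k l : nat) (H : {set {set V}}) :
  omitting_system k l H -> l < k -> 0 < #|V| ->
  #|minimal_extensible k (2 * l + 2) H| <= (\sum_(q < k.+1) sparsity q k) * #|V| ^ l.+1.
Proof.
move=> omH lk V0; set B := minimal_extensible _ _ _.
have Hk e : e \in H -> #|e| = k by move=> eH; case/andP: omH => /forall_inP/(_ _ eH)/eqP.
have BP S : S \in B -> [/\ 2 * l + 2 <= #|S|, extensible k H S & #|S| <= k].
  rewrite inE => /minsetP[/andP[Sa xS] _]; split=> //.
  have [|e [eH Se _]] := extensibleP _ _ _ xS set0; first by rewrite cards0.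
  by rewrite -(Hk _ eH) subset_leq_card.
rewrite (card_fibres (fun S : {set V} => inord #|S| : 'I_k.+1)) big_distrl /=.
apply: leq_sum => q _.
pose Hq := [set F : {ffun 'I_q -> V} | injectiveb F && ([set F i | i : 'I_q] \in B)].
have [->|[S0]] := set_0Vmem [set S in B | (inord #|S| : 'I_k.+1) == q]; first by rewrite cards0.
have sizeq S : S \in B -> (inord #|S| : 'I_k.+1) == q -> #|S| = q.
  by move=> /BP[_ _ Sk] /eqP <-; rewrite inordK.
rewrite inE => /andP[S0B /(sizeq _ S0B) S0q]; have [S0a _ _] := BP _ S0B.
apply: (@leq_trans #|Hq|).
  apply: leq_trans (leq_imset_card (fun F : {ffun 'I_q -> V} => [set F i | i : 'I_q]) Hq).
  apply/subset_leq_card/subsetP=> S; rewrite inE => /andP[SB /(sizeq _ SB) Sq].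
  pose F := [ffun i : 'I_q => enum_val (cast_ord (esym Sq) i)].
  have FE : [set F i | i : 'I_q] = S.
    apply/setP=> x; apply/imsetP/idP=> [[i _ ->]|xS]; first by rewrite ffunE enum_valP.
    exists (cast_ord Sq (enum_rank_in xS x)) => //.
    by rewrite ffunE cast_ordK enum_rankK_in.
  apply/imsetP; exists F => //; rewrite inE FE SB andbT; apply/injectiveP=> i j.
  by rewrite !ffunE => /enum_val_inj/cast_ord_inj.
have HqP F : F \in Hq -> injective F /\ [set F i | i : 'I_q] \in B.
  by rewrite inE => /andP[/injectiveP].
have := @sparse_family 'I_q V l k Hq; rewrite card_ord; apply=> //.
- by rewrite -ltnS ltn_ord.
- by lia.
- by move=> F /HqP[].
- move=> F G /HqP[_ FB] /HqP[_ GB] _; have [_ ? ?] := BP _ FB; have [_ ? ?] := BP _ GB.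
  exact: (extensible_omitting omH).
(* A rich [A] with at least [2 * l + 2] positions would make the image of [A] extensible: given [W],
   pick [G] avoiding [W] off [A], then an edge around the image of [G] avoiding the rest of [W].
   This contradicts minimality. *)
move=> F A FH AT rA; rewrite leqNgt; apply/negP=> Al.
have [Finj] := HqP _ FH; rewrite inE => /minsetP[_ /(_ [set F i | i in A])].
have FAc : #|[set F i | i in A]| = #|A| by rewrite card_imset.
have FAsub : [set F i | i in A] \subset [set F i | i : 'I_q].
  by apply/subsetP=> x /imsetP[i _ ->]; apply: imset_f.
move=> min; have /setP FAE : [set F i | i in A] = [set F i | i : 'I_q].
  apply: min => //; rewrite FAc; apply/andP; split; first by lia.
  apply/extensibleP=> W Wk; have [G [GH FG GW]] := richP _ _ _ _ rA _ Wk.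
  have [_ GB] := HqP _ GH; have [_ /extensibleP/(_ _ Wk)[e [eH Ge eW]] _] := BP _ GB.
  exists e; split=> //.
    apply: subset_trans Ge; apply/subsetP=> x /imsetP[i iA ->].
    by move/subsetP/(_ _ iA): FG; rewrite inE => /eqP ->; apply: imset_f.
  apply/subsetP=> x xeW; have /imsetP[i _ xG] := subsetP eW _ xeW.
  have iA : i \in A.
    apply/negPn/negP => /GW; rewrite -xG; by move: xeW; rewrite inE => /andP[_ ->].
  apply/imsetP; exists i => //; rewrite xG.
  by move/subsetP/(_ _ iA): FG; rewrite inE => /eqP ->.
case/negP: AT; apply/eqP/setP=> i; rewrite inE; have := FAE (F i).
by rewrite [RHS]imset_f // => /imsetP[j jA /Finj ->].
Qed.

(** Every edge is extensible and large enough to contain a minimal extensible set, so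
    [sparse_independent] yields a set independent for [H]. The parameter [r] is chosen in
    [g_lower]. *)
Lemma alpha_lower (V : finType) (k l r : nat) (H : {set {set V}}) :
  omitting_system k l H -> 2 * l + 1 < k -> 0 < #|V| ->
  #|V| * r.+1 ^ (2 * l + 1) <=
    alpha H * r.+1 ^ (2 * l + 2) + (\sum_(q < k.+1) sparsity q k) * #|V| ^ l.+1.
Proof.
move=> omH lk V0; have lk' : l < k by lia.
have Ble := card_minimal_extensible omH lk' V0.
have [|U indU Ule] := @sparse_independent V (minimal_extensible k (2 * l + 2) H) (2 * l + 1) r.
  by move=> S; rewrite inE => /minsetP[/andP[]]; rewrite addn1 addn2.
have Ua : #|U| <= alpha H.
  apply: (@leq_bigmax_cond _ (independent H) (fun A : {set V} => #|A|) U).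
  apply/forall_inP=> e eH; apply/negP=> eU.
  have [|S Smin Se] := @minset_exists _ (fun S => (2 * l + 2 <= #|S|) && extensible k H S) e.
    case/andP: omH => /forall_inP/(_ _ eH)/eqP -> _; apply/andP; split; first by lia.
    by apply/extensibleP=> W _; exists e; split=> //; apply: subsetIl.
  have/forall_inP/(_ S) := indU; rewrite inE Smin => /(_ isT)/negP; apply.
  exact: subset_trans eU.
apply: (leq_trans Ule); apply: leq_add => //.
by rewrite -addnS leq_mul2r Ua orbT.
Qed.

(** * Random cores in polynomial blocks *)

Definition block_index (F : finFieldType) (d : nat) : finType := ('rV[F]_d * F)%type.

(** Here [d] is [l - 1]. The constant coefficient is kept apart because varying it alone makes the
    value at a point run once through [F]. *)
Definition block_poly (F : finFieldType) (d : nat) (c : block_index F d) : {poly F} :=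
  (rVpoly c.1 * 'X + c.2%:P)%R.

Definition block_point (F : finFieldType) (d m : nat) (pt : 'I_m -> F)
    (c : block_index F d) (i : 'I_m) : 'I_m * F := (i, (block_poly c).[pt i]%R).

Lemma block_point_inj (F : finFieldType) (d m : nat) (pt : 'I_m -> F) (c : block_index F d) :
  injective (block_point pt c).
Proof. by move=> i j []. Qed.

(** Agreements are roots of the difference of the two polynomials, which is nonzero of degree at
    most [d]. *)
Lemma block_agreement (F : finFieldType) (d m : nat) (pt : 'I_m -> F)
    (c c' : block_index F d) : injective pt -> c != c' ->
  #|[set i | block_point pt c i == block_point pt c' i]| <= d.
Proof.
move=> pt_inj cc'; pose D := (rVpoly (c.1 - c'.1) * 'X + (c.2 - c'.2)%:P)%R.
have DE : D = (block_poly c - block_poly c')%R.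
  by rewrite /D /block_poly linearB /= polyCB; ring.
have sD : size D = (size (rVpoly (c.1 - c'.1)%R)).+1.
  rewrite size_MXaddC; case: ifP => // /andP[/eqP c1 /eqP c2].
  case/eqP: cc'; rewrite [c]surjective_pairing [c']surjective_pairing.
  congr (_, _); last by apply/eqP; rewrite -subr_eq0 c2.
  apply/eqP; rewrite -subr_eq0; apply/eqP; apply: (can_inj rVpolyK).
  by rewrite c1 linear0.
have D0 : (D != 0)%R by rewrite -size_poly_eq0 sD.
set S := [set i | _].
have := @max_poly_roots _ D [seq pt i | i in S] D0; rewrite size_map -cardE sD ltnS.
move=> le; apply: leq_trans (le _ _) (size_poly _ _).
  apply/allP=> y /mapP[i]; rewrite mem_enum inE => /eqP[E] ->.
  by rewrite rootE DE hornerD hornerN E subrr.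
by rewrite map_inj_uniq ?enum_uniq.
Qed.

(** With the core size tested in the edge condition, the system is omitting for every [s]: a block
    whose core has the wrong size carries no edge. *)
Definition block_system (F : finFieldType) (d m k l : nat) (pt : 'I_m -> F)
    (s : {ffun block_index F d -> {set 'I_m}}) : {set {set 'I_m * F}} :=
  [set e | [exists c, exists T : {set 'I_m},
     [&& e == block_point pt c @: T, #|T| == k, s c \subset T & #|s c| == l.+1]]].

Lemma block_systemP (F : finFieldType) (d m k l : nat) (pt : 'I_m -> F)
    (s : {ffun block_index F d -> {set 'I_m}}) (e : {set 'I_m * F}) :
  reflect (exists (c : block_index F d) (T : {set 'I_m}),
             [/\ e = block_point pt c @: T, #|T| = k, s c \subset T & #|s c| = l.+1])
          (e \in block_system k l pt s).
Proof.
rewrite inE; apply: (iffP existsP) => [[c /existsP[T /and4P[/eqP ? /eqP ? ? /eqP ?]]]|].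
  by exists c, T.
move=> [c [T [/eqP ? /eqP ? ? /eqP ?]]]; exists c; apply/existsP; exists T.
by apply/and4P.
Qed.

(** Edges of one block share its core of [d.+2] points, and edges of distinct blocks share at most
    [d]; the size [d.+1] is skipped. *)
Lemma block_system_omitting (F : finFieldType) (d m k : nat) (pt : 'I_m -> F)
    (s : {ffun block_index F d -> {set 'I_m}}) :
  injective pt -> omitting_system k d.+1 (block_system k d.+1 pt s).
Proof.
move=> pt_inj; apply/andP; split.
  apply/forall_inP=> e /block_systemP[c [T [-> Tk _ _]]].
  by rewrite card_imset ?Tk //; apply: block_point_inj.
apply/forall_inP=> e /block_systemP[c [T [-> Tk sT sl]]].
apply/forall_inP=> f /block_systemP[c' [T' [-> Tk' sT' sl']]].
apply/implyP=> _; have [E|cc'] := eqVneq c c'.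
  subst c'; have : #|block_point pt c @: s c| <=
      #|(block_point pt c @: T) :&: (block_point pt c @: T')|.
    by apply: subset_leq_card; rewrite subsetI !imsetS.
  by rewrite card_imset ?sl; [rewrite neq_ltn orbC => -> | apply: block_point_inj].
suff : #|(block_point pt c @: T) :&: (block_point pt c' @: T')| <= d by rewrite neq_ltn ltnS => ->.
apply: leq_trans (block_agreement pt_inj cc').
rewrite -(card_imset _ (@block_point_inj _ _ _ pt c)).
apply/subset_leq_card/subsetP=> x; rewrite inE => /andP[/imsetP[i _ xi] /imsetP[j _ xj]].
apply/imsetP; exists i => //; rewrite inE -xi xj; move: xi xj => -> /(congr1 fst) /= ->.
by [].
Qed.

Definition block_trace (F : finFieldType) (d m : nat) (pt : 'I_m -> F)
    (A : {set 'I_m * F}) (c : block_index F d) : {set 'I_m} :=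
  [set i | block_point pt c i \in A].

(** For every [u], a point lies on the block [(u, b)] for exactly one [b], hence on [#|F| ^ d]
    blocks in all. *)
Lemma sum_block_trace (F : finFieldType) (d m : nat) (pt : 'I_m -> F) (A : {set 'I_m * F}) :
  \sum_(c : block_index F d) #|block_trace pt A c| = #|F| ^ d * #|A|.
Proof.
rewrite -(pair_bigA _ (fun u b => #|block_trace pt A ((u, b) : block_index F d)|)) /=.
rewrite (eq_bigr (fun=> #|A|)); last first.
  move=> u _.
  have E b : #|block_trace pt A ((u, b) : block_index F d)| =
      \sum_i ((i, ((rVpoly u).[pt i] * pt i + b)%R) \in A).
    rewrite -sum1_card big_mkcond; apply: eq_bigr => i _.
    by rewrite inE /block_point /block_poly hornerMXaddC; case: (_ \in _).
  have -> : #|A| = \sum_i \sum_y ((i, y) \in A).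
    rewrite (pair_bigA _ (fun i y => nat_of_bool ((i, y) \in A))) -sum1_card big_mkcond /=.
    by apply: eq_bigr => -[i y] _ /=; case: ((i, y) \in A).
  rewrite (eq_bigr _ (fun b _ => E b)) exchange_big /=; apply: eq_bigr => i _.
  by rewrite [RHS](reindex_inj (addrI ((rVpoly u).[pt i] * pt i)%R)).
by rewrite sum_nat_const card_mx mul1n.
Qed.

Lemma leq_bin_lin (a j : nat) : 0 < j <= a -> a <= 'C(a, j) + j.-1.
Proof.
elim: a j => [|a IH] [|j] //= /ltnSE; rewrite leq_eqVlt => /orP[/eqP ->|ja].
  by rewrite binn; lia.
have := IH j.+1; rewrite ja binS /= => /(_ isT).
have : 0 < 'C(a, j) by rewrite bin_gt0; lia.
lia.
Qed.

Lemma leq_bin_expn (a j : nat) : 'C(a, j) <= a ^ j.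
Proof.
elim: j => [|j IH]; first by rewrite bin0.
have := mul_bin_left a j; rewrite expnS => E.
apply: (@leq_trans (j.+1 * 'C(a, j.+1))); first by rewrite leq_pmull.
by rewrite E leq_mul // leq_subr.
Qed.

(** The number of cores that put an edge inside a set meeting the block in [a] points; such an edge
    needs [k] of them. *)
Definition block_hits (k l : nat) (a : nat) : nat := if k <= a then 'C(a, l.+1) else 0.

(** Traces have mean size [k], and by [leq_bin_lin] a trace of size [a] has at least [a - k.-1]
    hits, so the mean number of hits is at least 1. *)
Lemma sum_block_hits (F : finFieldType) (d m k l : nat) (pt : 'I_m -> F) (A : {set 'I_m * F}) :
  l < k -> #|A| = k * #|F| ->
  #|F| ^ d.+1 <= \sum_(c : block_index F d) block_hits k l #|block_trace pt A c|.
Proof.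
move=> lk Ak; have := sum_block_trace d pt A; rewrite Ak => E.
have : \sum_(c : block_index F d) #|block_trace pt A c| <=
       \sum_(c : block_index F d) (block_hits k l #|block_trace pt A c| + k.-1).
  apply: leq_sum => c _; rewrite /block_hits; case: (leqP k #|_|) => [ka|ak]; last by lia.
  have := @leq_bin_lin #|block_trace pt A c| l.+1; rewrite /= (leq_trans lk ka) => /(_ isT).
  by move/leq_trans; apply; rewrite leq_add2l; lia.
rewrite big_split /= sum_nat_const E card_prod card_mx mul1n expnSr.
case: k lk {Ak E} => // k _ /=; set S := \sum_c _; nia.
Qed.

(** Cores of different blocks are chosen independently, so the count factors over the blocks. *)
Lemma count_avoiding_choices (F : finFieldType) (d m k l : nat) (pt : 'I_m -> F)
    (A : {set 'I_m * F}) :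
  \sum_(s : {ffun block_index F d -> {set 'I_m}})
     [forall c, (#|s c| == l.+1) && ~~ ((k <= #|block_trace pt A c|) && (s c \subset block_trace pt A c))]
  = \prod_(c : block_index F d) ('C(m, l.+1) - block_hits k l #|block_trace pt A c|).
Proof.
pose P (c : block_index F d) (S : {set 'I_m}) := (#|S| == l.+1) &&
  ~~ ((k <= #|block_trace pt A c|) && (S \subset block_trace pt A c)).
rewrite (eq_bigr (fun s : {ffun block_index F d -> {set 'I_m}} =>
  \prod_c nat_of_bool (P c (s c)))); last by move=> s _; rewrite (prod_nat_of_bool (fun c => P c (s c))).
rewrite -(bigA_distr_bigA (fun c S => nat_of_bool (P c S))); apply: eq_bigr => c _.
have -> : \sum_S nat_of_bool (P c S) = #|[set S | P c S]|.
  rewrite -sum1_card big_mkcond [RHS]big_mkcond; apply: eq_bigr => S _.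
  by rewrite inE; case: (P c S).
have binE : 'C(m, l.+1) = #|[set S : {set 'I_m} | #|S| == l.+1]|.
  by rewrite card_draws card_ord.
rewrite /block_hits /P binE; case: (leqP k #|_|) => [ka|ka] /=; last first.
  by rewrite subn0; apply: eq_card => S; rewrite !inE andbT.
rewrite -cards_draws.
rewrite -[X in X - _](cardsID [set S : {set 'I_m} | S \subset block_trace pt A c]).
set X := #|_ :&: _|; rewrite [X in _ - X](_ : _ = X); last first.
  by apply: eq_card => S; rewrite !inE andbC.
by rewrite addKn; apply: eq_card => S; rewrite !inE andbC.
Qed.

(* First moment: choose the cores [s c] uniformly at random; a set of [k * #|F|]
   points is independent with probability at most
   [expR (- #|F| ^ d.+1 / 'C(m, d.+2))]. *)
Lemma block_system_independent (R : realType) (F : finFieldType) (d m k : nat)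
    (pt : 'I_m -> F) (L : R) :
  d.+1 < k -> k <= m ->
  ((m * #|F|)%:R <= expR L)%R ->
  ((k * #|F|)%:R * L * 'C(m, d.+2)%:R < (#|F| ^ d.+1)%:R)%R ->
  exists s : {ffun block_index F d -> {set 'I_m}},
    forall A, independent (block_system k d.+1 pt s) A -> #|A| < k * #|F|.
Proof.
move=> dk km mL Lsmall; set N := 'C(m, d.+2) in Lsmall *; set q := #|F| in mL Lsmall *.
have N0 : 0 < N by rewrite bin_gt0; lia.
pose ok (s : {ffun block_index F d -> {set 'I_m}}) := [forall c, #|s c| == d.+2].
pose av A (s : {ffun block_index F d -> {set 'I_m}}) := [forall c, (#|s c| == d.+2) &&
  ~~ ((k <= #|block_trace pt A c|) && (s c \subset block_trace pt A c))].
pose draws := [set A : {set 'I_m * F} | #|A| == k * q].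
(* A core inside a trace of at least [k] points can be completed there to an edge contained in
   [A]. *)
have indep_av s A : ok s -> independent (block_system k d.+1 pt s) A -> av A s.
  move=> /forallP oks /forall_inP ind; apply/forallP=> c; rewrite oks /=.
  apply/negP=> /andP[ka sA]; have sk : #|s c| <= k by rewrite (eqP (oks c)).
  have [U UA Uc] : exists2 U : {set 'I_m}, U \subset block_trace pt A c :\: s c & #|U| = k - d.+2.
    by apply: subset_of_card; rewrite cardsD (setIidPr sA) (eqP (oks c)) leq_sub2r.
  have UsA : s c :|: U \subset block_trace pt A c.
    by rewrite subUset sA (subset_trans UA) ?subsetDl.
  have disj : s c :&: U = set0.
    apply/eqP; rewrite setI_eq0 disjoint_sym disjoint_subset; apply/subsetP=> i /(subsetP UA).
    by rewrite !inE => /andP[].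
  have eH : block_point pt c @: (s c :|: U) \in block_system k d.+1 pt s.
    apply/block_systemP; exists c, (s c :|: U); split=> //; last exact/eqP.
      by rewrite cardsU disj cards0 Uc (eqP (oks c)); lia.
    exact: subsetUl.
  move/negP: (ind _ eH); apply.
  by apply/subsetP=> x /imsetP[i /(subsetP UsA) iA ->]; rewrite inE in iA.
suff [s oks noA] : exists2 s, ok s & forall A, A \in draws -> ~~ av A s.
  exists s => A indA; rewrite ltnNge; apply/negP=> /subset_of_card[B BA Bc].
  have Bd : B \in draws by rewrite inE Bc.
  move/negP: (noA _ Bd); apply; apply: indep_av => //; apply/forall_inP=> e eH; apply/negP=> eB.
  by move/forall_inP/(_ _ eH)/negP: indA; apply; apply: subset_trans BA.
have [s /andP[oks /forall_inP sP]|none] := pickP (fun s => ok s && [forall A in draws, ~~ av A s]).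
  by exists s.
exfalso.
have count_ok : \sum_s ok s = N ^ (q ^ d.+1).
  rewrite (eq_bigr (fun s : {ffun block_index F d -> {set 'I_m}} =>
    \prod_c nat_of_bool (#|s c| == d.+2))); last first.
    by move=> s _; rewrite (prod_nat_of_bool (fun c => #|s c| == d.+2)).
  rewrite -(bigA_distr_bigA (fun (c : block_index F d) (S : {set 'I_m}) => nat_of_bool (#|S| == d.+2))).
  rewrite (eq_bigr (fun=> N)) => [|c _].
    by rewrite prod_nat_const card_prod card_mx mul1n expnSr.
  rewrite /N -[m in RHS](card_ord m) -card_draws -sum1_card [RHS]big_mkcond; apply: eq_bigr => S _.
  by rewrite inE; case: (_ == _).
have le1 : N ^ (q ^ d.+1) <= \sum_(A in draws)
    \prod_(c : block_index F d) (N - block_hits k d.+1 #|block_trace pt A c|).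
  rewrite -count_ok; under [X in _ <= X]eq_bigr => A _ do rewrite -count_avoiding_choices.
  rewrite exchange_big /=; apply: leq_sum => s _; case: (boolP (ok s)) => // oks.
  have := none s; rewrite oks /= => /negbT/forall_inPn[A Ad /negbNE Aav].
  by rewrite (bigD1 A) //=; move: Aav; rewrite /av => ->.
move: le1; apply/negP; rewrite -ltnNge -(ltr_nat R) natr_sum natrX.
have N0R : (0 < N%:R :> R)%R by rewrite ltr0n.
pose M : R := (N%:R ^+ (q ^ d.+1) * expR (- ((q ^ d.+1)%:R / N%:R)))%R.
have term A : A \in draws ->
    ((\prod_(c : block_index F d) (N - block_hits k d.+1 #|block_trace pt A c|))%:R <= M)%R.
  rewrite inE => /eqP Ac; rewrite natr_prod.
  (* The bound [1 - x <= expR (- x)] turns the product into an exponential of the total number of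
     hits. *)
  apply: (@le_trans _ _ (\prod_(c : block_index F d)
      (N%:R * expR (- ((block_hits k d.+1 #|block_trace pt A c|)%:R / N%:R))))%R).
    apply: ler_prod => c _; rewrite ler0n /=; set h := block_hits _ _ _.
    have hN : h <= N.
      rewrite /h /block_hits; case: ifP => // _; rewrite leq_bin2l //.
      by rewrite -[X in _ <= X]card_ord max_card.
    rewrite natrB // -[leLHS](_ : (N%:R * (1 + - (h%:R / N%:R)) = _)%R).
      by rewrite ler_pM2l // expR_ge1Dx.
    by rewrite mulrBr mulr1 mulrC divfK // gt_eqF.
  rewrite big_split /= prodr_const card_prod card_mx mul1n -expnSr -expR_sum.
  rewrite /M ler_pM2l ?exprn_gt0 // ler_expR sumrN lerN2 -mulr_suml.
  rewrite ler_pM2r ?invr_gt0 // -natr_sum ler_nat.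
  exact: sum_block_hits.
apply: (@le_lt_trans _ _ (\sum_(A in draws) M)%R); first exact: ler_sum.
rewrite sumr_const -[(M *+ _)%R]mulr_natr.
have dc : (#|draws|%:R <= expR ((k * q)%:R * L) :> R)%R.
  rewrite /draws card_draws card_prod card_ord -/q expRM_natl.
  apply: (@le_trans _ _ (((m * q) ^ (k * q))%:R)%R); first by rewrite ler_nat leq_bin_expn.
  by rewrite natrX lerXn2r // nnegrE ?ler0n // expR_ge0.
apply: (@le_lt_trans _ _ (M * expR ((k * q)%:R * L))%R).
  by rewrite ler_wpM2l // mulr_ge0 ?expR_ge0 // exprn_ge0 // ltW.
rewrite /M -mulrA -expRD gtr_pMr ?exprn_gt0 // -[X in (_ < X)%R]expR0 ltr_expR.
by rewrite addrC subr_lt0 ltr_pdivlMr.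
Qed.

Lemma imset_omitting (T T' : finType) (f : T -> T') (k l : nat) (H : {set {set T}}) :
  injective f -> omitting_system k l H ->
  omitting_system k l [set f @: (e : {set T}) | e in H].
Proof.
move=> f_inj /andP[/forall_inP Hk /forall_inP Hl]; apply/andP; split.
  by apply/forall_inP=> _ /imsetP[e eH ->]; rewrite card_imset // Hk.
apply/forall_inP=> _ /imsetP[e eH ->]; apply/forall_inP=> _ /imsetP[e' e'H ->].
apply/implyP=> ne; have /forall_inP/(_ _ e'H)/implyP := Hl _ eH.
rewrite -imsetI; last by move=> x y _ _; apply: f_inj.
by rewrite card_imset //; apply; apply: contraNneq ne => ->.
Qed.

(** Vertices outside the image of [f] lie in no edge and add at most [#|T'| - #|T|]. *)
Lemma alpha_imset (T T' : finType) (f : T -> T') (x : nat) (H : {set {set T}}) :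
  injective f -> (forall A, independent H A -> #|A| <= x) ->
  alpha [set f @: (e : {set T}) | e in H] <= x + (#|T'| - #|T|).
Proof.
move=> f_inj Hx; apply/bigmax_leqP=> A /forall_inP indA.
rewrite -(cardsID [set f y | y : T] A); apply: leq_add.
  have -> : A :&: [set f y | y : T] = f @: (f @^-1: A).
    apply/setP=> y; rewrite inE; apply/andP/imsetP=> [[yA /imsetP[z _ yz]]|[z zA ->]].
      by exists z => //; rewrite inE -yz.
    by move: zA; rewrite inE => ->; rewrite imset_f.
  rewrite card_imset //; apply: Hx; apply/forall_inP=> e eH; apply/negP=> eA.
  move/negP: (indA (f @: e) (imset_f _ eH)); apply.
  by apply/subsetP=> _ /imsetP[z /(subsetP eA) zA ->]; rewrite inE in zA.
apply: (@leq_trans #|~: [set f y | y : T]|); first by apply: subset_leq_card; rewrite setDE subsetIr.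
by rewrite cardsCs setCK card_imset.
Qed.

Lemma g_le_field (R : realType) (F : finFieldType) (d k n : nat) :
  d.+1 < k -> 0 < n -> n < #|F| * #|F| ->
  (k%:R * n%:R ^+ d.+2 * ln n%:R < #|F|%:R ^+ (2 * d.+1) :> R)%R ->
  g n k d.+1 <= k.+1 * #|F|.
Proof.
move=> dk n0 nq small; set q := #|F| in nq small *.
have q0 : 0 < q by apply/card_gt0P; exists 0%R.
pose m := n %/ q.
have nE : n = m * q + n %% q := divn_eq n q.
have rq : n %% q < q by rewrite ltn_mod.
have mq : m <= q by rewrite ltnW // ltn_divLR.
(* If [m < k] then [n < k * q], and the bound is trivial. *)
have [km|mk] := leqP k m; last first.
  have [H omH <-] := g_attained n k d.+1.
  apply/bigmax_leqP=> A _; apply: leq_trans (max_card _) _; rewrite card_ord; nia.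
pose pt (i : 'I_m) : F := enum_val (widen_ord mq i).
have pt_inj : injective pt by move=> i j /enum_val_inj/(congr1 val) /= /val_inj.
have mqn : m * q <= n by rewrite [X in _ <= X]nE leq_addr.
have nR : (0 < n%:R :> R)%R by rewrite ltr0n.
have ln0 : (0 <= ln n%:R :> R)%R by rewrite ln_ge0 // ler1n.
have qR : (0 < q%:R :> R)%R by rewrite ltr0n.
have [||s sP] := @block_system_independent R F d m k pt (ln n%:R) dk km.
- by rewrite lnK ?posrE // ler_nat.
(* After multiplying by [q ^ d.+2], the hypothesis [small] suffices, because
   ['C(m, d.+2) * q ^ d.+2] is at most [n ^ d.+2]. *)
- rewrite -(@ltr_pM2r _ (q%:R ^+ d.+2)) ?exprn_gt0 // natrX -exprD.
  rewrite (_ : d.+1 + d.+2 = (2 * d.+1).+1); last by lia.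
  rewrite exprS; apply: (@le_lt_trans _ _ (q%:R * (k%:R * n%:R ^+ d.+2 * ln n%:R))%R); last first.
    by rewrite ltr_pM2l.
  have binle : (('C(m, d.+2))%:R * q%:R ^+ d.+2 <= n%:R ^+ d.+2 :> R)%R.
    rewrite -!natrX -natrM ler_nat (leq_trans _ (_ : (m * q) ^ d.+2 <= _)) //.
      by rewrite expnMn leq_mul2r leq_bin_expn orbT.
    by rewrite leq_exp2r.
  rewrite natrM; set Nn := (n%:R ^+ d.+2)%R in binle *; set Q := (q%:R ^+ d.+2)%R in binle *.
  set C := ('C(m, d.+2)%:R)%R in binle *.
  have -> : (k%:R * q%:R * ln n%:R * C * Q = k%:R * q%:R * ln n%:R * (C * Q))%R by ring.
  have -> : (q%:R * (k%:R * Nn * ln n%:R) = k%:R * q%:R * ln n%:R * Nn)%R by ring.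
  by rewrite ler_wpM2l // !mulr_ge0 // ?ler0n.
have Wn : #|{: 'I_m * F}| <= n by rewrite card_prod card_ord.
pose io (x : 'I_m * F) : 'I_n := widen_ord Wn (enum_rank x).
have io_inj : injective io by move=> x y /(congr1 val) /= /val_inj/enum_rank_inj.
apply: leq_trans (g_le (imset_omitting io_inj (block_system_omitting k s pt_inj))) _.
apply: leq_trans (@alpha_imset _ _ io (k * q) _ io_inj _) _; first by move=> A /sP/ltnW.
rewrite card_prod !card_ord -/q mulSn; lia.
Qed.

(** * Asymptotics *)

Local Open Scope ring_scope.

Lemma truncnS_bounds (R : realType) (y : R) :
  1 <= y -> y <= (Num.truncn y).+1%:R <= 2 * y.
Proof.
move=> y1; have y0 : 0 <= y by lra.
have /andP[ty yt] := truncn_itv y0.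
by rewrite (ltW yt) /= -natr1; lra.
Qed.

(** Take [r.+1] of order [K * n ^ (l / (2 l + 1))] with [K ^ (2 l + 1) = 2 D]. The error term of
    [alpha_lower] is then at most half of its left side. The 4 in the constant is one factor 2 from
    this halving and one from rounding [r]. *)
Lemma g_lower (R : realType) (k l : nat) : (2 * l + 1 < k)%N ->
  exists2 c : R, 0 < c & forall n : nat, (0 < n)%N ->
    c * n%:R `^ ((l%:R + 1) / (2 * l%:R + 1)) <= (g n k l)%:R.
Proof.
move=> lk; pose D := (\sum_(q < k.+1) sparsity q k)%N.
have D1 : (1 <= D)%N.
  rewrite /D (bigD1 ord0) //= ltn_addr // /sparsity muln_gt0 expn_gt0 muln_gt0 //.
pose p : R := (2 * l + 1)%N%:R.
have pE : p = 2 * l%:R + 1 by rewrite /p natrD natrM.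
have p0 : 0 < p by rewrite ltr0n; lia.
pose K : R := (2 * D%:R) `^ p^-1.
have twoD1 : 1 <= 2 * D%:R :> R by rewrite -natrM ler1n; lia.
have K1 : 1 <= K.
  by rewrite -[1](powRr0 (2 * D%:R)) ler_powR // invr_ge0 ltW.
exists (4 * K)^-1; first by rewrite invr_gt0; lra.
move=> n n0; rewrite -pE.
have n1 : 1 <= n%:R :> R by rewrite ler1n.
have [H omH <-] := g_attained n k l.
pose e1 : R := n%:R `^ ((l%:R + 1) / p); pose e2 : R := n%:R `^ (l%:R / p).
have e2_ge1 : 1 <= e2.
  by rewrite -[1](powRr0 n%:R) ler_powR // divr_ge0 ?ler0n // ltW.
have e12 : e1 * e2 = n%:R.
  rewrite -powRD; last by rewrite pnatr_eq0 -lt0n n0 implybT.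
  rewrite -mulrDl (_ : l%:R + 1 + l%:R = p) ?divff ?powRr1 ?gt_eqF ?ler0n //.
  by rewrite pE; ring.
have Kp : K ^+ (2 * l + 1) = 2 * D%:R.
  by rewrite -powR_mulrn ?powR_ge0 // -powRrM mulVf ?gt_eqF // powRr1 //; lra.
have e2p : e2 ^+ (2 * l + 1) = n%:R ^+ l.
  rewrite -powR_mulrn ?powR_ge0 // -powRrM divfK ?gt_eqF //.
  by rewrite powR_mulrn.
have y1 : 1 <= K * e2 by rewrite mulr_ege1.
have /andP[yr ry] := truncnS_bounds y1; set r := Num.truncn _ in yr ry.
have yp : 2 * D%:R * n%:R ^+ l <= r.+1%:R ^+ (2 * l + 1) :> R.
  by rewrite -Kp -e2p -exprMn lerXn2r // nnegrE ?ler0n //; lra.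
have := @alpha_lower 'I_n k l r H omH lk; rewrite card_ord -/D => /(_ n0).
rewrite -(ler_nat R) natrD !natrM !natrX.
set a : R := (alpha H)%:R; set x : R := r.+1%:R in yr ry yp *.
rewrite (_ : (2 * l + 2 = (2 * l + 1).+1)%N); last by lia.
rewrite !exprS; set X := x ^+ _ in yp *; set nl := n%:R ^+ l in yp * => main.
have x1 : 1 <= x by rewrite ler1n.
have X0 : 0 < X by rewrite exprn_gt0 //; lra.
have a0 : 0 <= a by rewrite ler0n.
have nx : n%:R <= 2 * a * x.
  have : n%:R * X <= 2 * a * x * X by nra.
  by rewrite ler_pM2r.
have : e1 * e2 <= 4 * a * K * e2 by rewrite e12; nra.
rewrite ler_pM2r; last by lra.
move=> e1le; rewrite ler_pdivrMl; [|lra]; rewrite -/e1; nra.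
Qed.

(** Supplies the order of a finite field within a factor 2 of a given real; the exponent is positive
    so that such a field exists. *)
Lemma pow2_between (R : realType) (z : R) : 1 <= z ->
  exists r : nat, z < (2 ^ r.+1)%:R <= 2 * z.
Proof.
move=> z1; have z0 : 0 <= z by lra.
have /andP[tz zt] := truncn_itv z0; set t := Num.truncn z in tz zt.
have t0 : (0 < t)%N by rewrite truncn_gt0.
exists (trunc_log 2 t); have /andP[lo hi] := @trunc_log_bounds 2 t isT t0.
apply/andP; split; first by apply: lt_le_trans zt _; rewrite ler_nat.
apply: le_trans (_ : (2 * t)%:R <= _); last by rewrite natrM ler_pM2l.
by rewrite ler_nat expnS leq_mul2l.
Qed.

(** [g_le_field] is applied with [q] between [z] and [2 z], where
    [z ^ (2 l) = k * n ^ (l + 1) * ln n]. This gives the logarithm the exponent [1 / (2 l)], which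
    is relaxed to [1 / l]. *)
Lemma g_upper (R : realType) (k l : nat) : (0 < l < k)%N ->
  exists2 C : R, 0 < C & exists N : nat, forall n : nat, (N <= n)%N ->
    (g n k l)%:R <= C * n%:R `^ ((l%:R + 1) / (2 * l%:R)) * (ln n%:R) `^ (1 / l%:R).
Proof.
case: l => // d /= dk; set l : R := d.+1%:R.
have l0 : 0 < l by rewrite ltr0n.
have k1 : 1 <= k%:R :> R by rewrite ler1n; lia.
pose p : R := (2 * d.+1)%N%:R.
have pE : p = 2 * l by rewrite /p natrM.
have p0 : 0 < p by rewrite pE; lra.
exists (k.+1%:R * 2 * k%:R `^ p^-1).
  by rewrite !mulr_gt0 ?ltr0n // powR_gt0; lra.
(* From here on [ln n >= 1], so raising its exponent only increases the bound. *)
exists (Num.truncn (expR 1 : R)).+1 => n Nn.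
have en : expR 1 <= n%:R :> R.
  have /andP[_ /ltW e] := truncn_itv (expR_ge0 (1 : R)).
  by apply: le_trans e _; rewrite ler_nat.
have n0 : (0 < n)%N by apply: leq_trans Nn.
have n1 : 1 <= n%:R :> R by rewrite ler1n.
have ln1 : 1 <= ln n%:R :> R by rewrite -ler_expR lnK // posrE ltr0n.
pose X : R := k%:R * n%:R ^+ d.+2 * ln n%:R.
have X1 : 1 <= X by rewrite mulr_ege1 // mulr_ege1 // exprn_ege1.
pose z := X `^ p^-1.
have z1 : 1 <= z by rewrite -[1](powRr0 X) ler_powR // invr_ge0 ltW.
have zp : z ^+ (2 * d.+1) = X.
  by rewrite -powR_mulrn ?powR_ge0 // -powRrM mulVf ?gt_eqF // powRr1 //; lra.
have [r /andP[zq qz]] := pow2_between z1; set q := (2 ^ r.+1)%N in zq qz.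
have [F _ Fq] := @pPrimePowerField 2 r.+1 isT isT; rewrite -/q in Fq.
have Xq : X < q%:R ^+ (2 * d.+1).
  by rewrite -zp ltr_pXn2r // nnegrE ?ler0n //; lra.
(* Otherwise [q ^ (2 l) <= n ^ l <= X], against [Xq]. *)
have nq : (n < q * q)%N.
  rewrite ltnNge; apply/negP=> qn; move: Xq; apply/negP; rewrite -leNgt.
  apply: (@le_trans _ _ (n%:R ^+ d.+1)).
    rewrite exprM lerXn2r ?nnegrE ?exprn_ge0 ?ler0n //.
    by rewrite expr2 -natrM ler_nat.
  rewrite /X [n%:R ^+ d.+2]exprS.
  have P1 : 1 <= n%:R ^+ d.+1 :> R by rewrite exprn_ege1.
  have : n%:R ^+ d.+1 <= n%:R * n%:R ^+ d.+1 :> R by rewrite ler_peMl //; lra.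
  move/le_trans; apply; set Y := n%:R * _.
  have Y0 : 0 <= Y by rewrite mulr_ge0 //; lra.
  have kY : Y <= k%:R * Y by rewrite ler_peMl.
  by apply: le_trans kY _; rewrite ler_peMr // mulr_ge0 //; lra.
have := @g_le_field R F d k n dk n0; rewrite Fq => /(_ nq Xq).
rewrite -(ler_nat R) natrM => /le_trans; apply.
have zE : z = k%:R `^ p^-1 * n%:R `^ ((l + 1) / (2 * l)) * (ln n%:R) `^ p^-1.
  have lnn : 0 <= ln n%:R :> R by lra.
  have kn : 0 <= k%:R :> R by lra.
  have nd : 0 <= n%:R ^+ d.+2 :> R by rewrite exprn_ge0 ?ler0n.
  rewrite /z /X (powRM _ (mulr_ge0 kn nd) lnn) (powRM _ kn nd).
  suff -> : (n%:R ^+ d.+2) `^ p^-1 = n%:R `^ ((l + 1) / (2 * l)) :> R by [].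
  rewrite -powR_mulrn ?ler0n // -powRrM pE.
  by have -> : d.+2%:R = l + 1 :> R by rewrite /l natr1.
have lnle : (ln n%:R) `^ p^-1 <= (ln n%:R) `^ (1 / l) :> R.
  rewrite ler_powR // div1r lef_pV2 ?posrE // pE; lra.
apply: (@le_trans _ _ (k.+1%:R * (2 * z))); first by rewrite ler_pM2l ?ltr0n.
rewrite zE (_ : k.+1%:R * (2 * _) = k.+1%:R * 2 * k%:R `^ p^-1 *
  n%:R `^ ((l + 1) / (2 * l)) * ln n%:R `^ p^-1); last by ring.
by rewrite ler_wpM2l // !mulr_ge0 ?powR_ge0 ?ler0n.
Qed.

Theorem theorem1p4 (R : realType) (k l : nat) (hl : (2 <= l)%N)
    (hk : (2 * l + 1 < k)%N) :
  exists c C : R, [/\ 0 < c, 0 < C &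
    exists N : nat, forall n : nat, (N <= n)%N ->
      c * Num.max (n%:R `^ ((l%:R + 1) / (3 * l%:R - 1)))
                  (n%:R `^ ((l%:R + 1) / (k%:R - 1)))
        <= (g n k l)%:R
      /\ (g n k l)%:R
        <= C * n%:R `^ ((l%:R + 1) / (2 * l%:R)) * (ln n%:R) `^ (1 / l%:R)].
Proof.
have [c c0 lower] := g_lower R hk.
have lk : (0 < l < k)%N by lia.
have [C C0 [N upper]] := g_upper R lk.
exists c, C; split=> //; exists (maxn N 1) => n; rewrite geq_max => /andP[Nn n0].
split; last exact: upper.
apply: le_trans (lower n n0); rewrite ler_pM2l //.
have n1 : 1 <= n%:R :> R by rewrite ler1n.
have l2 : 2 <= l%:R :> R by rewrite ler_nat.
have k2 : 2 * l%:R + 2 <= k%:R :> R.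
  by rewrite -natrM -natrD ler_nat; lia.
(* Both denominators are at least [2 l + 1]: the first since [l >= 2], the second since
   [k >= 2 l + 2]. *)
rewrite ge_max; apply/andP; split; rewrite ler_powR // ler_pM2l ?lef_pV2 ?posrE; lra.
Qed.
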